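(* Let $n = p_1^{\alpha_1}\cdots p_r^{\alpha_r}$ be the prime factorisation of a positive integer $n$ (distinct primes, $\alpha_i>0$). Then \[\det(A_n) = \prod_{\substack{d_1, d_2 \mid n\\ 1 \le d_1 < d_2 \le n}} \mathcal{R}(\Phi_{d_2}, \Phi_{d_1}) = (-1)^{n-1}\prod_{i=1}^r p_i^{\frac{n(1-p_i^{-\alpha_i})}{p_i-1}}.\]
   Context: $\Phi_d$ is the $d$th cyclotomic polynomial. $\Psi_n : \mathbf{Z}[X]/(X^n-1) \to \bigoplus_{d \mid n} \mathbf{Z}[X]/(\Phi_d(X))$ is the natural map $f\bmod(X^n-1)\mapsto\bigoplus_{d\mid n}f\bmod\Phi_d(X)$, and $A_n$ is its matrix with respect to the basis $(1,\overline{X},\dots,\overline{X}^{n-1})$ of the domain and the bases $(1,\overline{X},\dots,\overline{X}^{\phi(d)-1})$ of the summands, with summands ordered by increasing $d$ (the $j$th column of $A_n$ is the coordinate vector of $\Psi_n(\overline{X}^j)$). For monic polynomials $f,g$, the resultant is $\mathcal{R}(f,g) = \prod_{\alpha}\prod_{\beta}(\alpha-\beta)$, the product over the roots $\alpha$ of $f$ and $\beta$ of $g$ (with multiplicity) in an algebraic closure. *)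

(* Defs.v *)
From HB Require Import structures.
From mathcomp Require Import all_boot all_order all_algebra all_field.
Set Implicit Arguments. Unset Strict Implicit. Unset Printing Implicit Defensive.
Import Order.TTheory GRing.Theory Num.Theory.
Local Open Scope ring_scope.

Definition rootsC (f : {poly int}) : seq algC :=
  sval (closed_field_poly_normal (map_poly (fun z : int => z%:~R : algC) f)).

(* Resultant of monic f, g: product over roots alpha of f and beta of g of (alpha - beta). *)
Definition resC (f g : {poly int}) : algC :=
  \prod_(a <- rootsC f) \prod_(b <- rootsC g) (a - b).

Definition row_labels (n : nat) : seq (nat * nat) :=
  flatten [seq [seq (d, k) | k <- iota 0 (totient d)] | d <- divisors n].

(* The matrix A_n of Psi_n: column j is the coordinate vector of
   (X^j mod Phi_d)_{d | n} in the bases (1, X, ..., X^{phi(d)-1}). *)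
Definition A_mat (n : nat) : 'M[int]_n :=
  \matrix_(i < n, j < n)
    let dk := nth (0%N, 0%N) (row_labels n) i in
    (('X ^+ j %% 'Phi_(dk.1)) : {poly int})`_(dk.2).

(* Main.v *)
Require Import Defs.
From HB Require Import structures.
From mathcomp Require Import all_boot all_order all_algebra all_field.
Set Implicit Arguments. Unset Strict Implicit. Unset Printing Implicit Defensive.
Import Order.TTheory GRing.Theory Num.Theory.
Local Open Scope ring_scope.

(** The determinant. Let D be the block diagonal matrix whose block at d | n is
    the Vandermonde matrix of the roots of Phi_d. Evaluating X^j mod Phi_d at the
    roots of Phi_d shows that D A_n is the Vandermonde matrix of all n-th roots of
    unity, so det A_n is the product of the differences of roots that belong to
    distinct divisors.

    The closed form. Up to sign, write n = p^a m with p not dividing m. The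
    polynomials Phi_(p^i d), i <= a, multiply to Phi_d(X^(p^a)), and substituting
    X^k in both arguments raises a resultant to the k-th power; so the pairs over
    distinct d | m contribute the (p^a)-th power of the product for m. The pairs
    over a single d contribute powers of R(Phi_(pd), Phi_d) = +- p^phi(d), which is
    obtained by differentiating Phi_d Phi_(pd) = Phi_d(X^p) at the roots of Phi_d.

    The sign. For d > 2 the roots of Phi_d come in pairs of conjugate non-real
    numbers, so R(Phi_d, g) >= 0 for every g; only R(Phi_2, Phi_1) is negative. *)

(** * Resultants of monic integer polynomials *)

Local Notation ZtoC := (fun z : int => z%:~R : algC).
Local Notation pZtoC := (map_poly ZtoC).

Lemma pZtoC_monic f : f \is monic -> pZtoC f \is monic.
Proof.
move=> f1; rewrite monicE (@lead_coef_map_inj _ _ (intmul 1)) ?(monicP f1) //.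
exact: intr_inj.
Qed.

Lemma pZtoC_rootsC f :
  f \is monic -> pZtoC f = \prod_(z <- rootsC f) ('X - z%:P).
Proof.
move=> f1; rewrite /rootsC; case: closed_field_poly_normal => s /= {1}->.
by rewrite (monicP (pZtoC_monic f1)) scale1r.
Qed.

Lemma perm_rootsC f s :
  f \is monic -> pZtoC f = \prod_(z <- s) ('X - z%:P) -> perm_eq (rootsC f) s.
Proof. by move=> f1; rewrite pZtoC_rootsC // => /prod_XsubC_eq. Qed.

Lemma mem_rootsC f z : f \is monic -> (z \in rootsC f) = root (pZtoC f) z.
Proof. by move=> f1; rewrite pZtoC_rootsC // root_prod_XsubC. Qed.

Lemma size_rootsC f : f \is monic -> size (rootsC f) = (size f).-1.
Proof.
move=> f1; rewrite -(@size_map_inj_poly _ _ ZtoC) //; last exact: intr_inj.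
by rewrite pZtoC_rootsC // size_prod_XsubC.
Qed.

Lemma resC_horner f g :
  g \is monic -> resC f g = \prod_(a <- rootsC f) (pZtoC g).[a].
Proof.
move=> g1; apply: eq_bigr => a _; rewrite pZtoC_rootsC // horner_prod.
by apply: eq_bigr => b _; rewrite hornerXsubC.
Qed.

Lemma rootsCM f g : f \is monic -> g \is monic ->
  perm_eq (rootsC (f * g)) (rootsC f ++ rootsC g).
Proof.
move=> f1 g1; apply: perm_rootsC; first by rewrite monicMl.
by rewrite big_cat -!pZtoC_rootsC // rmorphM.
Qed.

Lemma resCMl f g h : f \is monic -> g \is monic ->
  resC (f * g) h = resC f h * resC g h.
Proof. by move=> f1 g1; rewrite /resC (perm_big _ (rootsCM f1 g1)) big_cat. Qed.

Lemma resCMr f g h : g \is monic -> h \is monic ->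
  resC f (g * h) = resC f g * resC f h.
Proof.
move=> g1 h1; rewrite !resC_horner ?monicMl // -big_split /=.
by apply: eq_bigr => a _; rewrite rmorphM hornerM.
Qed.

Lemma rootsC1 : rootsC 1 = [::].
Proof. by apply/nilP; rewrite /nilp size_rootsC ?monic1 // size_poly1. Qed.

Lemma resC_prodl (I : Type) (r : seq I) (F : I -> {poly int}) g :
    (forall i, F i \is monic) ->
  resC (\prod_(i <- r) F i) g = \prod_(i <- r) resC (F i) g.
Proof.
move=> F1; elim: r => [|i r IHr]; first by rewrite !big_nil /resC rootsC1 big_nil.
by rewrite !big_cons resCMl ?IHr // monic_prod.
Qed.

Lemma resC_prodr (I : Type) (r : seq I) (F : I -> {poly int}) f :
    (forall i, F i \is monic) ->
  resC f (\prod_(i <- r) F i) = \prod_(i <- r) resC f (F i).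
Proof.
move=> F1; elim: r => [|i r IHr].
  by rewrite !big_nil /resC rootsC1 big1 // => a _; rewrite big_nil.
by rewrite !big_cons resCMr ?IHr // monic_prod.
Qed.

Lemma norm_resC_sym f g : `|resC f g| = `|resC g f|.
Proof.
rewrite /resC exchange_big /= !normr_prod; apply: eq_bigr => a _.
by rewrite !normr_prod; apply: eq_bigr => b _; rewrite distrC.
Qed.

Lemma comp_Xn_monic (f : {poly int}) k :
  (0 < k)%N -> f \is monic -> f \Po 'X^k \is monic.
Proof.
move=> k0 f1; rewrite monicE lead_coef_comp ?size_polyXn //.
by rewrite (monicP f1) lead_coefXn expr1n mulr1.
Qed.

(** The roots of f(X^k) are the k-th roots z of the roots a of f, and g(X^k) takes the value g(a) at
    each of the k such z. *)
Lemma resC_comp_Xn f g k : (0 < k)%N -> f \is monic -> g \is monic ->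
  resC (f \Po 'X^k) (g \Po 'X^k) = resC f g ^+ k.
Proof.
move=> k0 f1 g1.
(* [s a] lists the roots of X^k - a with multiplicity, so it has k entries even when a = 0. *)
pose s a := sval (closed_field_poly_normal ('X^k - a%:P : {poly algC})).
have sE a : 'X^k - a%:P = \prod_(z <- s a) ('X - z%:P).
  rewrite /s; case: closed_field_poly_normal => t /= {1}->.
  by rewrite lead_coefDl ?size_polyXn ?lead_coefXn ?scale1r // size_polyN size_polyC;
     case: (a == 0).
have sX a z : z \in s a -> z ^+ k = a.
  by rewrite -root_prod_XsubC -sE rootE !hornerE subr_eq0 => /eqP.
have size_s a : size (s a) = k.
  apply: succn_inj; rewrite -(size_prod_XsubC (s a) id) -sE.
  by rewrite size_polyDl size_polyXn // size_polyN size_polyC; case: (a == 0).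
have sf : perm_eq (rootsC (f \Po 'X^k)) (flatten (map s (rootsC f))).
  apply: perm_rootsC; first exact: comp_Xn_monic.
  rewrite map_comp_poly /= map_polyXn pZtoC_rootsC // rmorph_prod /=.
  rewrite big_flatten big_map; apply: eq_bigr => a _.
  by rewrite comp_polyB comp_polyX comp_polyC sE.
rewrite !resC_horner ?comp_Xn_monic // (perm_big _ sf) big_flatten big_map /=.
rewrite -prodrXl; apply: eq_bigr => a _.
rewrite (eq_big_seq (fun=> (pZtoC g).[a])) => [|z /sX za].
  by rewrite big_const_seq count_predT size_s iter_mulr_1.
by rewrite map_comp_poly /= map_polyXn horner_comp hornerXn za.
Qed.

(** * Cyclotomic polynomials and prime powers *)

Lemma mem_rootsC_Cyclotomic d z : (0 < d)%N ->
  (z \in rootsC 'Phi_d) = d.-primitive_root z.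
Proof.
move=> d0; have [w w_prim] := C_prim_root_exists d0.
by rewrite mem_rootsC ?Cyclotomic_monic // (Cintr_Cyclotomic w_prim) root_cyclotomic.
Qed.

Lemma size_rootsC_Cyclotomic d : size (rootsC 'Phi_d) = totient d.
Proof. by rewrite size_rootsC ?Cyclotomic_monic // size_Cyclotomic. Qed.

(** Phi_d divides X^d - 1, which is separable in characteristic 0. *)
Lemma uniq_rootsC_Cyclotomic d : (0 < d)%N -> uniq (rootsC 'Phi_d).
Proof.
move=> d0; rewrite -separable_prod_XsubC -pZtoC_rootsC ?Cyclotomic_monic //.
have: separable_poly ('X^d - 1 : {poly algC}).
  by rewrite separable_Xn_sub_1 // pnatr_eq0 -lt0n.
suff ->: 'X^d - 1 = pZtoC ('X^d - 1).
  rewrite -prod_Cyclotomic // (big_rem d) ?divisors_id //= rmorphM /=.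
  by rewrite separable_mul => /and3P[].
by rewrite rmorphB rmorph1 /= map_polyXn.
Qed.

Lemma pfactor_mul_inj p d e i j : prime p -> ~~ (p %| d)%N -> ~~ (p %| e)%N ->
  (p ^ i * d == p ^ j * e)%N = (d == e) && (i == j).
Proof.
move=> p_pr; have logE c k : ~~ (p %| c)%N -> logn p (p ^ k * c) = k.
  move=> pNc; have c0 : (0 < c)%N.
    by rewrite lt0n; apply: contraNneq pNc => ->; rewrite dvdn0.
  rewrite lognM ?expn_gt0 ?(prime_gt0 p_pr) // pfactorK //.
  by rewrite lognE (negPf pNc) !andbF addn0.
move=> pNd pNe; apply/eqP/andP => [eq_de | [/eqP-> /eqP->]] //.
have eq_ij : i = j by rewrite -(logE d i pNd) eq_de logE.
split; last exact/eqP.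
by move/eqP: eq_de; rewrite eq_ij eqn_pmul2l // expn_gt0 prime_gt0.
Qed.

Lemma perm_divisors_pfactor p a m : prime p -> ~~ (p %| m)%N -> (0 < m)%N ->
  perm_eq (divisors (p ^ a * m))
          [seq (p ^ i * d)%N | d <- divisors m, i <- iota 0 a.+1].
Proof.
move=> p_pr pNm m0; have p0 := prime_gt0 p_pr.
have pNd d : d \in divisors m -> ~~ (p %| d)%N.
  by rewrite -dvdn_divisors // => dm; apply: contra pNm => /dvdn_trans; exact.
apply: uniq_perm; first exact: divisors_uniq.
  apply: allpairs_uniq; rewrite ?divisors_uniq ?iota_uniq // => -[d i] [d' i'].
  move=> /allpairsP[[e j] [em _ [-> ->]]] /allpairsP[[e' j'] [em' _ [-> ->]]] /=.
  by move/eqP; rewrite pfactor_mul_inj ?pNd // => /andP[/eqP-> /eqP->].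
have co_pm i : coprime (p ^ i) m by rewrite coprimeXl // prime_coprime.
move=> e; rewrite -dvdn_divisors ?muln_gt0 ?expn_gt0 ?p0 //.
apply/idP/allpairsPdep => [eD | [d [i [dm i_a ->]]]]; last first.
  rewrite mem_iota ltnS in i_a.
  by apply: dvdn_mul; [exact: dvdn_exp2l | rewrite dvdn_divisors].
have e0: (0 < e)%N by apply: dvdn_gt0 eD; rewrite muln_gt0 expn_gt0 p0.
have [e' e'p eE] := pfactor_coprime p_pr e0.
have e'm: (e' %| m)%N.
  rewrite -(@Gauss_dvdr _ (p ^ a)) ?coprimeXr //; last by rewrite coprime_sym.
  by apply: dvdn_trans eD; rewrite eE dvdn_mulr.
exists e', (logn p e); split; [by rewrite -dvdn_divisors | | by rewrite mulnC].
rewrite mem_iota ltnS /= -(@dvdn_Pexp2l p) ?prime_gt1 //.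
rewrite -(@Gauss_dvdl _ _ m) ?coprimeXl ?prime_coprime //.
by apply: dvdn_trans eD; exact: pfactor_dvdnn.
Qed.

(** Strong induction on d. Multiplied over all divisors of d, both sides give X^(p^a d) - 1; the
    factors at proper divisors agree by induction and cancel, being monic. *)
Lemma Cyclotomic_comp_pexp p a d : prime p -> ~~ (p %| d)%N -> (0 < d)%N ->
  \prod_(i <- iota 0 a.+1) 'Phi_(p ^ i * d) = 'Phi_d \Po 'X^(p ^ a).
Proof.
move=> p_pr; elim/ltn_ind: d => d IHd pNd d0.
have pa0 : (0 < p ^ a)%N by rewrite expn_gt0 prime_gt0.
have eqX : \prod_(e <- divisors d) \prod_(i <- iota 0 a.+1) 'Phi_(p ^ i * e) =
           \prod_(e <- divisors d) ('Phi_e \Po 'X^(p ^ a)).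
  rewrite -[RHS](rmorph_prod (comp_poly _)) /= prod_Cyclotomic //.
  rewrite comp_polyB comp_Xn_poly -exprM comp_polyC.
  rewrite -prod_Cyclotomic ?muln_gt0 ?pa0 //.
  by rewrite (perm_big _ (perm_divisors_pfactor a p_pr pNd d0)) big_allpairs_dep.
move: eqX; rewrite !(big_rem d (divisors_id d0)) /=.
rewrite [X in _ * X](eq_big_seq (fun e => 'Phi_e \Po 'X^(p ^ a))); last first.
  move=> e; rewrite mem_rem_uniq ?divisors_uniq // inE -dvdn_divisors // => /andP[ed e_d].
  apply: IHd; last exact: dvdn_gt0 e_d.
    by rewrite ltn_neqAle ed dvdn_leq.
  by apply: contra pNd => /dvdn_trans; exact.
apply: mulIf; apply: monic_neq0; apply: monic_prod => e _.
by apply: comp_Xn_monic => //; exact: Cyclotomic_monic.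
Qed.

Lemma Cyclotomic_comp_p p d : prime p -> ~~ (p %| d)%N -> (0 < d)%N ->
  'Phi_d * 'Phi_(p * d) = 'Phi_d \Po 'X^p.
Proof.
move=> p_pr pNd d0; rewrite -[p in 'X^p]expn1 -Cyclotomic_comp_pexp //.
by rewrite /= !big_cons big_nil mulr1 expn0 expn1 mul1n.
Qed.

(** Divide the identity of [Cyclotomic_comp_pexp] for exponent j+1 by the one for exponent j. *)
Lemma Cyclotomic_pexpS p j d : prime p -> ~~ (p %| d)%N -> (0 < d)%N ->
  'Phi_(p ^ j.+1 * d) = 'Phi_(p * d) \Po 'X^(p ^ j).
Proof.
move=> p_pr pNd d0; have pj0 : (0 < p ^ j)%N by rewrite expn_gt0 prime_gt0.
have f1 := comp_Xn_monic pj0 (Cyclotomic_monic d).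
apply: (mulfI (monic_neq0 f1)); rewrite -comp_polyM Cyclotomic_comp_p //.
rewrite -comp_polyA comp_Xn_poly -exprM -expnSr -Cyclotomic_comp_pexp //.
by rewrite -(Cyclotomic_comp_pexp j.+1) // -[in RHS]addn1 iotaD big_cat /= big_seq1.
Qed.

(** With f = Phi_d and g = Phi_(pd), differentiating f g = f(X^p) at a root z of f gives |g(z)|
    |f'(z)| = p |f'(z^p)|, as |z| = 1. In the product over z the derivatives cancel, since z -> z^p
    permutes the roots. *)
Lemma norm_resC_Cyclotomic_p p d : prime p -> ~~ (p %| d)%N -> (0 < d)%N ->
  `|resC 'Phi_(p * d) 'Phi_d| = p%:R ^+ totient d.
Proof.
move=> p_pr pNd d0; rewrite norm_resC_sym.
rewrite resC_horner ?Cyclotomic_monic // -size_rootsC_Cyclotomic.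
set s := rootsC 'Phi_d; set f := pZtoC 'Phi_d; set g := pZtoC _.
have Df : f * g = f \Po 'X^p.
  rewrite /f /g -rmorphM /= Cyclotomic_comp_p //.
  by rewrite map_comp_poly /= map_polyXn.
have s_prim z : (z \in s) = d.-primitive_root z by exact: mem_rootsC_Cyclotomic.
have us : uniq s by exact: uniq_rootsC_Cyclotomic.
have sp : perm_eq (map (fun z => z ^+ p) s) s.
  have sub : {subset map (fun z => z ^+ p) s <= s}.
    move=> _ /mapP[z zs ->]; move: zs; rewrite !s_prim => z_prim.
    by rewrite prim_root_exp_coprime // prime_coprime.
  have us' : uniq (map (fun z => z ^+ p) s).
    (* The Bezout relation u p = 1 + v d makes the u-th power undo the p-th power on the roots. *)
    have /(coprimeP _ (prime_gt0 p_pr))[[u v] /= uv] : coprime p d.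
      by rewrite prime_coprime.
    have pK z : z \in s -> (z ^+ p) ^+ u = z.
      rewrite s_prim => /prim_expr_order zd.
      have -> : z ^+ p ^+ u = z ^+ (1 + v * d).
        rewrite -exprM mulnC -uv subnK //; apply: ltnW.
        by rewrite -subn_gt0 uv.
      by rewrite exprD mulnC exprM zd expr1n mulr1.
    by rewrite map_inj_in_uniq // => z w /pK {2}<- /pK {2}<- ->.
  have [|_ eq_s] := uniq_min_size us' sub; first by rewrite size_map.
  exact: uniq_perm.
have f's : \prod_(z <- s) `|f^`().[z]| != 0.
  rewrite prodf_seq_neq0; apply/allP => z zs /=; rewrite normr_eq0.
  have sf : separable_poly f.
    by rewrite /f pZtoC_rootsC ?Cyclotomic_monic // separable_prod_XsubC.
  move: sf; rewrite unlock => /coprimep_root; apply.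
  by rewrite /f -mem_rootsC // Cyclotomic_monic.
apply: (mulIf f's).
have key z : z \in s -> `|g.[z]| * `|f^`().[z]| = p%:R * `|f^`().[z ^+ p]|.
  move=> zs; move: (congr1 (fun h => h^`().[z]) Df).
  rewrite derivM deriv_comp derivXn !hornerE horner_comp hornerXn.
  have /rootP-> : root f z by rewrite /f -mem_rootsC // Cyclotomic_monic.
  rewrite mul0r addr0 -normrM mulrC => ->.
  rewrite hornerMn hornerXn normrM mulrC -mulr_natl normrM normr_nat normrX.
  have zd : z ^+ d = 1 by apply: prim_expr_order; rewrite -s_prim.
  have -> : `|z| = 1 by apply/eqP; rewrite -(@pexpr_eq1 _ _ d) // -normrX zd normr1.
  by rewrite expr1n mulr1.
rewrite normr_prod -big_split /= (eq_big_seq _ key) big_split /=.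
rewrite big_const_seq count_predT iter_mulr_1; congr (_ * _).
by rewrite -[RHS](perm_big _ sp) big_map.
Qed.

(** * The absolute value of the product of resultants *)

(** Each unordered pair is counted twice on the left. That side does not refer to the order, so it
    survives a reindexing of the divisors that does not respect [<]. *)
Lemma prod_neq_sym (R : comRingType) (s : seq nat) (g : nat -> nat -> R) :
    (forall x y, g x y = g y x) ->
  \prod_(x <- s) \prod_(y <- s | x != y) g x y =
  (\prod_(x <- s) \prod_(y <- s | (y < x)%N) g x y) ^+ 2.
Proof.
move=> gC; rewrite expr2.
have {2}-> : \prod_(x <- s) \prod_(y <- s | (y < x)%N) g x y =
             \prod_(x <- s) \prod_(y <- s | (x < y)%N) g x y.
  rewrite (exchange_big_dep predT) //=.
  by apply: eq_bigr => x _; apply: eq_bigr => y _.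
rewrite -big_split; apply: eq_bigr => x _ /=.
rewrite (bigID (fun y => (y < x)%N)) /=; congr (_ * _); apply: eq_bigl => y.
  by rewrite neq_ltn andb_orl andbC; case: ltngtP.
by rewrite neq_ltn; case: ltngtP.
Qed.

Local Notation nresC d e := `|resC 'Phi_d 'Phi_e|.

(* Absolute values make the factors symmetric, so that the divisors may be taken
   in any order. *)
Definition nresC_prod n :=
  \prod_(x <- divisors n) \prod_(y <- divisors n | (y < x)%N) nresC x y.

Lemma nresC_prod_ge0 n : 0 <= nresC_prod n.
Proof. by apply: prodr_ge0 => x _; apply: prodr_ge0 => y _. Qed.

Lemma nresC_prod_sqr n :
  \prod_(x <- divisors n) \prod_(y <- divisors n | x != y) nresC x y =
  nresC_prod n ^+ 2.
Proof. by apply: prod_neq_sym => x y; exact: norm_resC_sym. Qed.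

(** For i = j+1 the factors with smaller exponent multiply to Phi_d(X^(p^j)), while Phi_(p^i d) is
    Phi_(pd)(X^(p^j)). Their resultant is the (p^j)-th power of R(Phi_(pd), Phi_d). *)
Lemma nresC_prod_pexp p a d : prime p -> ~~ (p %| d)%N -> (0 < d)%N ->
  \prod_(i <- iota 0 a.+1) \prod_(j <- iota 0 a.+1 | (j < i)%N)
     nresC (p ^ i * d) (p ^ j * d) =
  p%:R ^+ (totient d * \sum_(j < a) p ^ j).
Proof.
move=> p_pr pNd d0; rewrite -[a.+1]subn0 -/(index_iota 0 a.+1).
transitivity (\prod_(0 <= i < a.+1) \prod_(0 <= j < i) nresC (p ^ i * d) (p ^ j * d)).
  rewrite !big_nat; apply: eq_bigr => i /andP[_ ia].
  by rewrite [RHS](big_nat_widen _ _ a.+1) // ltnW.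
rewrite big_nat_recl // [X in X * _]big_geq // mul1r big_mkord.
rewrite big_distrr /= -prodrXr; apply: eq_bigr => j _.
rewrite -normr_prod -resC_prodr; last by move=> i; exact: Cyclotomic_monic.
rewrite /index_iota subn0 Cyclotomic_comp_pexp // Cyclotomic_pexpS //.
rewrite resC_comp_Xn ?Cyclotomic_monic ?expn_gt0 ?prime_gt0 //.
by rewrite normrX norm_resC_Cyclotomic_p // exprM.
Qed.

Lemma nresC_pexp_cross p a d e : prime p ->
    ~~ (p %| d)%N -> ~~ (p %| e)%N -> (0 < d)%N -> (0 < e)%N ->
  \prod_(i <- iota 0 a.+1) \prod_(j <- iota 0 a.+1) nresC (p ^ i * d) (p ^ j * e) =
  nresC d e ^+ (p ^ a).
Proof.
move=> p_pr pNd pNe d0 e0.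
under eq_bigr => i _.
  rewrite -normr_prod -resC_prodr; last by move=> j; exact: Cyclotomic_monic.
  over.
rewrite -normr_prod -resC_prodl; last by move=> j; exact: Cyclotomic_monic.
rewrite !Cyclotomic_comp_pexp //.
by rewrite resC_comp_Xn ?Cyclotomic_monic ?expn_gt0 ?prime_gt0 // normrX.
Qed.

Lemma sum_totient_divisors n : (0 < n)%N -> \sum_(d <- divisors n) totient d = n.
Proof.
move=> n0; rewrite -[RHS]cyclic.sum_totient_dvd.
rewrite -(big_mkord (dvdn^~ n) totient) -big_filter.
apply: perm_big; apply: uniq_perm; rewrite ?divisors_uniq ?filter_uniq ?iota_uniq //.
move=> d; rewrite mem_filter mem_index_iota /= ltnS -dvdn_divisors //.
by case: (boolP (d %| n)%N) => // /dvdn_leq->.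
Qed.

Lemma nresC_prodM p a m : prime p -> ~~ (p %| m)%N -> (0 < m)%N ->
  nresC_prod (p ^ a * m) =
  p%:R ^+ (m * \sum_(j < a) p ^ j) * nresC_prod m ^+ (p ^ a).
Proof.
move=> p_pr pNm m0.
have pNd d : d \in divisors m -> ~~ (p %| d)%N.
  by rewrite -dvdn_divisors // => dm; apply: contra pNm => /dvdn_trans; exact.
have d_gt0 d : d \in divisors m -> (0 < d)%N.
  by rewrite -dvdn_divisors //; exact: dvdn_gt0.
(* Both sides are nonnegative, so it suffices to compare squares, which are products over all pairs
   of distinct divisors. *)
apply: (pexpIrn (n := 2)) => //; rewrite ?nnegrE ?nresC_prod_ge0 //.
  by rewrite mulr_ge0 ?exprn_ge0 ?nresC_prod_ge0 ?ler0n.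
rewrite -nresC_prod_sqr (perm_big _ (perm_divisors_pfactor a p_pr pNm m0)).
rewrite big_allpairs_dep exprMn [_ ^+ (p ^ a) ^+ 2]exprAC -nresC_prod_sqr.
(* Writing m as the sum of the totients of its divisors d spreads the power of p over d, so that the
   two sides can be compared for each d. *)
rewrite -[X in p%:R ^+ (X * _)](sum_totient_divisors m0) big_distrl /=.
rewrite -prodrXr -!prodrXl -big_split /=.
apply: eq_big_seq => d dm.
under eq_bigr => i _.
  rewrite (perm_big _ (perm_divisors_pfactor a p_pr pNm m0)) big_mkcond big_allpairs_dep.
  rewrite (bigD1_seq d) ?divisors_uniq //=.
  over.
(* The term e = d collects pairs of distinct exponents over one d; the terms e <> d are the cross
   products of [nresC_pexp_cross]. *)
rewrite big_split /=; congr (_ * _).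
  rewrite -nresC_prod_pexp ?pNd ?d_gt0 //.
  rewrite -(@prod_neq_sym _ _ (fun i j => nresC (p ^ i * d) (p ^ j * d))); last first.
    by move=> i j; exact: norm_resC_sym.
  apply: eq_bigr => i _; rewrite -big_mkcond; apply: eq_bigl => j.
  by rewrite pfactor_mul_inj ?pNd // eqxx.
rewrite exchange_big /= -prodrXl.
rewrite [RHS](eq_bigl (fun e => e != d)); last by move=> e; rewrite eq_sym.
rewrite big_mkcond [RHS]big_mkcond; apply: eq_big_seq => e em; case: ifP => // ed.
rewrite -nresC_pexp_cross ?pNd ?d_gt0 //; apply: eq_bigr => i _.
by apply: eq_bigr => j _; rewrite pfactor_mul_inj ?pNd // [d == e]eq_sym (negPf ed).
Qed.

(** Both divisions are exact: for n = q^b m the exponent n(1 - q^-b)/(q-1) is m (q^b - 1)/(q-1), a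
    multiple of a geometric sum. *)
Lemma pexponentE q b m : prime q ->
  ((q ^ b * m - q ^ b * m %/ q ^ b) %/ (q - 1) = m * \sum_(j < b) q ^ j)%N.
Proof.
move=> q_pr; have q0 := prime_gt0 q_pr.
rewrite mulKn ?expn_gt0 ?q0 // -[X in (_ - X)%N]mul1n -mulnBl !subn1 predn_exp.
by rewrite -mulnA mulKn; [rewrite mulnC | rewrite -subn1 subn_gt0 prime_gt1].
Qed.

Lemma nresC_prodE n : (0 < n)%N ->
  nresC_prod n =
  \prod_(p <- primes n) p%:R ^+ ((n - n %/ p ^ logn p n) %/ (p - 1))%N.
Proof.
elim/ltn_ind: n => n IHn n0.
case: (leqP n 1) => [n1 | n_gt1].
  have -> : n = 1%N by apply/eqP; rewrite eqn_leq n1.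
  rewrite /nresC_prod /= big_nil big_seq1 big_mkcond big_seq1.
  by rewrite ltnn.
set p := pdiv n; have p_pr : prime p by exact: pdiv_prime.
have [m] := pfactor_coprime p_pr n0; rewrite prime_coprime // => pNm.
have a0 : (0 < logn p n)%N by rewrite logn_gt0 mem_primes p_pr n0 pdiv_dvd.
move: a0; set a := logn p n => a0; rewrite mulnC => nE.
have m0 : (0 < m)%N by rewrite lt0n; apply: contraNneq pNm => ->; rewrite dvdn0.
have pa0 : (0 < p ^ a)%N by rewrite expn_gt0 prime_gt0.
have primes_n : perm_eq (primes n) (p :: primes m).
  apply: uniq_perm; rewrite ?primes_uniq //= ?primes_uniq ?andbT.
    by rewrite mem_primes (negPf pNm) !andbF.
  by move=> q; rewrite nE primesM // primesX // primes_prime // !inE.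
rewrite (perm_big _ primes_n) big_cons {1}nE nresC_prodM //.
congr (_ * _); first by rewrite -/a {1 2}nE pexponentE.
rewrite IHn //; last by rewrite nE ltn_Pmull // -{1}(expn0 p) ltn_exp2l ?prime_gt1.
rewrite -prodrXl; apply: eq_big_seq => q.
rewrite mem_primes => /and3P[q_pr _ qm].
have qNp : q != p by apply: contraNneq pNm => <-.
have -> : logn q n = logn q m.
  by rewrite nE lognM // lognX logn_prime // (negPf qNp) muln0.
have [k _ mE] := pfactor_coprime q_pr m0; set b := logn q m in mE *.
(* Taken at c = 1 for m and at c = p^a for n: the exponent of q is multiplied by p^a, which matches
   the power in [nresC_prodM]. *)
have expE c : ((c * m - c * m %/ q ^ b) %/ (q - 1) = c * k * \sum_(j < b) q ^ j)%N.
  by rewrite mE mulnA mulnC pexponentE.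
have := expE 1%N; rewrite !mul1n => expE1.
by rewrite -exprM expE1 nE expE mulnC mulnA.
Qed.

(** * The sign *)

Lemma resC_Cyclotomic_ge0 d e : (2 < d)%N -> 0 <= resC 'Phi_d 'Phi_e.
Proof.
move=> d2; have d0 : (0 < d)%N by apply: leq_trans d2.
rewrite resC_horner ?Cyclotomic_monic //.
set s := rootsC _; set f := pZtoC _.
have s_prim z : (z \in s) = d.-primitive_root z by exact: mem_rootsC_Cyclotomic.
have us : uniq s by exact: uniq_rootsC_Cyclotomic.
have fJ z : f.[z^*] = (f.[z])^*.
  rewrite -horner_map /=; congr (_.[_]); rewrite -map_poly_comp.
  by apply: eq_map_poly => x; rewrite /= rmorph_int.
have sJ z : (z^* \in s) = (z \in s) by rewrite !s_prim fmorph_primitive_root.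
have sJs : perm_eq (map (fun z => z^*) s) s.
  apply: uniq_perm => //; first by rewrite map_inj_uniq //; exact: fmorph_inj.
  by move=> z; rewrite -{1}[z]conjCK mem_map ?sJ //; exact: fmorph_inj.
(* A real root of unity has square 1, which would force d to divide 2. *)
have Im_neq0 z : z \in s -> 'Im z != 0.
  rewrite s_prim => z_prim; apply/eqP => Imz0.
  have zR : z \is Num.real by apply/Creal_ImP.
  have z2 : z ^+ 2 = 1.
    apply/eqP; rewrite -real_normK // -(@pexpr_eq1 _ _ d) // ?exprn_ge0 //.
    by rewrite exprAC -normrX (prim_expr_order z_prim) normr1 expr1n.
  have : (d %| 2)%N by rewrite (prim_order_dvd z_prim) z2.
  by move/dvdn_leq => /(_ isT); rewrite leqNgt d2.
(* The roots in the lower half plane are the conjugates of those in the upper one, so the product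
   has the form w times the conjugate of w. *)
rewrite (bigID (fun z => 0 < 'Im z)) /=.
rewrite -[X in _ * X](perm_big _ sJs) big_map /=.
have -> : \prod_(z <- s | ~~ (0 < 'Im z^*)) f.[z^*] =
          (\prod_(z <- s | 0 < 'Im z) f.[z])^*.
  rewrite rmorph_prod /= big_mkcond [RHS]big_mkcond; apply: eq_big_seq => z zs.
  rewrite fJ Im_conj oppr_gt0 -real_leNgt ?real0 ?Creal_Im //.
  by rewrite le_eqVlt eq_sym (negPf (Im_neq0 z zs)).
exact: mul_conjC_ge0.
Qed.

Lemma resC_Cyclotomic2_le0 : resC 'Phi_2 'Phi_1 <= 0.
Proof.
have root1 z : z \in rootsC 'Phi_1 -> z = 1.
  by rewrite mem_rootsC_Cyclotomic // => /prim_expr_order; rewrite expr1.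
have root2 z : z \in rootsC 'Phi_2 -> z = -1.
  rewrite mem_rootsC_Cyclotomic // => z_prim; have /eqP := prim_expr_order z_prim.
  rewrite sqrf_eq1 => /orP[]/eqP // z1.
  by have := prim_order_dvd z_prim 1; rewrite expr1 z1 eqxx.
rewrite /resC.
have := size_rootsC_Cyclotomic 1; have := size_rootsC_Cyclotomic 2.
case E2: (rootsC 'Phi_2) => [|z [|? ?]] // _.
case E1: (rootsC 'Phi_1) => [|w [|? ?]] // _.
rewrite !big_seq1 (root2 z) ?E2 ?mem_head // (root1 w) ?E1 ?mem_head //.
by rewrite -opprD oppr_le0 addr_ge0 ?ler01.
Qed.

Lemma resC_prodE n : (0 < n)%N ->
  \prod_(d1 <- divisors n) \prod_(d2 <- divisors n | (d1 < d2)%N)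
      resC 'Phi_d2 'Phi_d1 = (-1) ^+ n.-1 * nresC_prod n.
Proof.
move=> n0; rewrite (exchange_big_dep predT) //= /nresC_prod.
(* n-1 is odd exactly when 2 divides n, so the whole sign can be attached to the factor at d = 2. *)
have -> : (-1) ^+ n.-1 = \prod_(d <- divisors n) (-1) ^+ (d == 2%N) :> algC.
  rewrite prodrXr -(signr_odd _ n.-1); congr (_ ^+ _).
  have -> : odd n.-1 = (2 \in divisors n).
    by rewrite -dvdn_divisors // dvdn2; case: n n0 => //= n; rewrite negbK.
  rewrite -count_uniq_mem ?divisors_uniq // -sum1_count.
  by rewrite [in LHS]big_mkcond; apply: eq_bigr => d _ /=; case: eqP.
rewrite -big_split /=; apply: eq_big_seq => d dn.
have d0 : (0 < d)%N by move: dn; rewrite -dvdn_divisors //; exact: dvdn_gt0.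
case: eqP => [-> | /eqP dN2]; last first.
  rewrite mul1r big_mkcond [RHS]big_mkcond; apply: eq_big_seq => e en.
  have e0 : (0 < e)%N by move: en; rewrite -dvdn_divisors //; exact: dvdn_gt0.
  case: ifP => // ed; rewrite ger0_norm // resC_Cyclotomic_ge0 //.
  by rewrite ltn_neqAle eq_sym dN2 (leq_ltn_trans e0).
(* At d = 2 the only smaller divisor is 1. *)
have divisors_lt2 F : \prod_(e <- divisors n | (e < 2)%N) F e = F 1%N :> algC.
  rewrite big_mkcond (bigD1_seq 1%N) ?divisor1 ?divisors_uniq //=.
  rewrite big_seq_cond big1 ?mulr1 // => e /andP[en e1]; case: ltnP => // e2.
  move: en; rewrite -dvdn_divisors // => /(dvdn_gt0 n0); move: e1 e2.
  by case: e => [|[|]].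
by rewrite !divisors_lt2 ler0_norm ?resC_Cyclotomic2_le0 // mulN1r opprK.
Qed.

(** * The determinant *)

(** The Vandermonde product of a list; recursion on the list lets it split along concatenated
    blocks. *)
Fixpoint vdm_prod (R : comRingType) (s : seq R) : R :=
  if s is x :: s' then \prod_(y <- s') (y - x) * vdm_prod s' else 1.

Lemma vdm_prod_cat (R : comRingType) (s t : seq R) :
  vdm_prod (s ++ t) =
  vdm_prod s * vdm_prod t * \prod_(y <- t) \prod_(x <- s) (y - x).
Proof.
elim: s => [|x s IHs] /=.
  by rewrite mul1r [X in _ * X]big1 ?mulr1 // => y _; rewrite big_nil.
rewrite big_cat IHs /=; under [X in _ = _ * X]eq_bigr do rewrite big_cons.
rewrite big_split /= -!mulrA; congr (_ * _); rewrite mulrCA; congr (_ * _).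
by rewrite mulrCA.
Qed.

Lemma det_Vandermonde_seq (R : comRingType) n (s : seq R) : size s = n ->
  \det (Vandermonde n (\row_(j < n) s`_j)) = vdm_prod s.
Proof.
move=> <-; rewrite det_Vandermonde.
under eq_bigr do under eq_bigr do rewrite !mxE.
elim: s => [|x s IHs] /=; first by rewrite big_ord0.
rewrite big_ord_recl /= -IHs; congr (_ * _).
  by rewrite big_mkcond big_ord_recl /= mul1r (big_nth 0) big_mkord.
apply: eq_bigr => i _; rewrite big_mkcond big_ord_recl /= mul1r.
by rewrite [RHS]big_mkcond.
Qed.

(** Groups the differences by their later point, the form in which they appear on the diagonal in
    [det_block_vdm]. *)
Lemma vdm_prod_take (R : comRingType) (s : seq R) :
  \prod_(k <- iota 0 (size s)) \prod_(z <- take k s) (s`_k - z) = vdm_prod s.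
Proof.
elim: s => [|x s IHs] /=; first by rewrite big_nil.
rewrite big_cons big_nil mul1r (iotaDl 1 0) big_map -IHs.
under eq_bigr do rewrite /= big_cons.
by rewrite big_split /= [in RHS](big_nth 0) /index_iota subn0.
Qed.

(** As [ds] increases strictly, a later block has the larger index, so the cross differences of
    [vdm_prod_cat] already carry the sign of d1 < d2. *)
Lemma vdm_prod_flatten (R : comRingType) (f : nat -> seq R) (ds : seq nat) :
    sorted ltn ds ->
  vdm_prod (flatten (map f ds)) =
  \prod_(d <- ds) vdm_prod (f d) *
  \prod_(d1 <- ds) \prod_(d2 <- ds | (d1 < d2)%N)
    \prod_(a <- f d2) \prod_(b <- f d1) (a - b).
Proof.
elim: ds => [|d ds IHds] /=; first by rewrite !big_nil mulr1.
move=> d_ds; rewrite vdm_prod_cat IHds ?(path_sorted d_ds) // !big_cons.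
rewrite ltnn -!mulrA; congr (_ * _); congr (_ * _); rewrite mulrC; congr (_ * _).
  rewrite big_flatten big_map [RHS]big_mkcond; apply: eq_big_seq => e e_ds.
  have -> // : (d < e)%N.
  by move: d_ds; rewrite path_sortedE; [case/andP => /allP/(_ e e_ds) | exact: ltn_trans].
apply: eq_big_seq => e e_ds; rewrite big_cons ifF //; apply/negbTE.
rewrite -leqNgt ltnW //.
by move: d_ds; rewrite path_sortedE; [case/andP => /allP/(_ e e_ds) | exact: ltn_trans].
Qed.

Lemma big_row_labels (R : Type) (idx : R) (op : Monoid.com_law idx) n F :
  \big[op/idx]_(a <- row_labels n) F a =
  \big[op/idx]_(d <- divisors n) \big[op/idx]_(k <- iota 0 (totient d)) F (d, k).
Proof.
by rewrite /row_labels big_flatten big_map; apply: eq_bigr => d _; rewrite big_map.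
Qed.

Lemma size_row_labels n : (0 < n)%N -> size (row_labels n) = n.
Proof.
move=> n0; rewrite -[RHS]sum_totient_divisors // -sum1_size big_row_labels.
by apply: eq_bigr => d _; rewrite sum1_size size_iota.
Qed.

Lemma mem_row_labels n d k :
  ((d, k) \in row_labels n) = (d \in divisors n) && (k < totient d)%N.
Proof.
apply/flatten_mapP/andP => [[e en /mapP[j]] | [dn kd]].
  by rewrite mem_iota => /andP[_ jd] [-> ->].
by exists d => //; apply/mapP; exists k; rewrite ?mem_iota.
Qed.

(** Within one divisor the labels increase along the rows; the triangularity of the block matrices
    rests on this. *)
Lemma row_labels_pairwise n :
  pairwise (fun a b => (a.1 == b.1) ==> (a.2 < b.2)%N) (row_labels n).
Proof.
rewrite /row_labels; have := divisors_uniq n.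
elim: (divisors n) => //= d ds IHds /andP[dNds /IHds{}IHds].
rewrite pairwise_cat IHds andbT; apply/andP; split.
  apply/allrelP => a b /mapP[k _ ->] /flatten_mapP[e e_ds /mapP[j _ ->]] /=.
  by apply/implyP => /eqP ed; rewrite ed e_ds in dNds.
rewrite pairwise_map; have := iota_ltn_sorted 0 (totient d).
rewrite sorted_pairwise; last exact: ltn_trans.
by apply: sub_pairwise => i j /= ->; rewrite implybT.
Qed.

Section BlockMatrix.

Variable n : nat.
Hypothesis n_gt0 : (0 < n)%N.

Definition lab (i : nat) := nth (0%N, 0%N) (row_labels n) i.
Local Notation rts d := (rootsC 'Phi_d).
Definition lroot (a : nat * nat) := (rts a.1)`_a.2.
Definition newton d k := \prod_(z <- take k (rts d)) ('X - z%:P).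

Lemma lab_mem (i : 'I_n) : lab i \in row_labels n.
Proof. by rewrite mem_nth // size_row_labels. Qed.

Lemma lab_divisor (i : 'I_n) : (lab i).1 \in divisors n.
Proof. by have := lab_mem i; case: (lab i) => d k; rewrite mem_row_labels => /andP[]. Qed.

Lemma lab_lt (i : 'I_n) : ((lab i).2 < totient (lab i).1)%N.
Proof. by have := lab_mem i; case: (lab i) => d k; rewrite mem_row_labels => /andP[]. Qed.

Lemma lab_ltn (i j : 'I_n) :
  (i < j)%N -> (lab i).1 = (lab j).1 -> ((lab i).2 < (lab j).2)%N.
Proof.
move=> ij eq1; have /(pairwiseP (0%N, 0%N)) := row_labels_pairwise n.
move=> /(_ i j); rewrite !inE size_row_labels // => /(_ (ltn_ord i) (ltn_ord j) ij).
by move/implyP; apply; apply/eqP.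
Qed.

Lemma big_lab (R : Type) (idx : R) (op : Monoid.com_law idx) F :
  \big[op/idx]_(i < n) F (lab i) =
  \big[op/idx]_(d <- divisors n) \big[op/idx]_(k <- iota 0 (totient d)) F (d, k).
Proof.
by rewrite -big_row_labels [RHS](big_nth (0%N, 0%N)) size_row_labels // big_mkord.
Qed.

Lemma sum_same_block (i : 'I_n) (F : nat -> algC) :
  \sum_(l < n) (if (lab i).1 == (lab l).1 then F (lab l).2 else 0) =
  \sum_(k < totient (lab i).1) F k.
Proof.
rewrite (big_lab _ (fun b => if (lab i).1 == b.1 then F b.2 else 0)) /=.
rewrite (bigD1_seq (lab i).1) ?lab_divisor ?divisors_uniq //=.
rewrite [X in _ + X]big1 ?addr0 => [|d dN]; last first.
  by rewrite big1 // => k _; rewrite eq_sym (negPf dN).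
by rewrite eqxx -[totient _]subn0 -/(index_iota 0 _) big_mkord subn0.
Qed.

Lemma horner_lroot (i : 'I_n) (p : {poly algC}) :
    (size p <= totient (lab i).1)%N ->
  \sum_(k < totient (lab i).1) lroot (lab i) ^+ k * p`_k = p.[lroot (lab i)].
Proof.
move=> p_le; rewrite (horner_coef_wide _ p_le).
by apply: eq_bigr => k _; rewrite mulrC.
Qed.

Lemma root_lroot (i : 'I_n) : root (pZtoC 'Phi_((lab i).1)) (lroot (lab i)).
Proof.
rewrite -mem_rootsC ?Cyclotomic_monic // mem_nth // size_rootsC_Cyclotomic.
exact: lab_lt.
Qed.

(** The block diagonal matrix D. Comparing the divisors in the labels encodes the blocks without
    dependent block sizes. *)
Definition block_vdm : 'M[algC]_n := \matrix_(i, j)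
  if (lab i).1 == (lab j).1 then lroot (lab i) ^+ (lab j).2 else 0.
(* Columns are the Newton polynomials of the roots of each block; this matrix is
   unitriangular and makes [block_vdm] triangular. *)
Definition block_newton : 'M[algC]_n := \matrix_(i, j)
  if (lab i).1 == (lab j).1 then (newton (lab j).1 (lab j).2)`_((lab i).2) else 0.

(** Row i of D evaluates a remainder modulo Phi_d at a root of Phi_d, where it agrees with X^j. The
    transpose appears because [Vandermonde] indexes its points by columns. *)
Lemma mul_block_vdm_A_mat :
  block_vdm *m map_mx ZtoC (A_mat n) = (Vandermonde n (\row_(i < n) lroot (lab i)))^T.
Proof.
apply/matrixP => i j; rewrite !mxE.
pose r := pZtoC (('X ^+ j) %% 'Phi_((lab i).1)).
rewrite (eq_bigr (fun l : 'I_n => if (lab i).1 == (lab l).1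
    then (fun k => lroot (lab i) ^+ k * r`_k) (lab l).2 else 0)); last first.
  move=> l _; rewrite !mxE /= -/(lab l); case: eqP => [eq_il|]; last by rewrite mul0r.
  by rewrite /r coef_map /= eq_il.
rewrite (sum_same_block i (fun k => lroot (lab i) ^+ k * r`_k)) horner_lroot; last first.
  rewrite -ltnS -size_Cyclotomic size_map_inj_poly //; last exact: intr_inj.
  by rewrite ltn_modp monic_neq0 // Cyclotomic_monic.
(* Over the integers the Euclidean identity for [%%] requires a divisor whose leading coefficient is
   a unit. *)
have lc : lead_coef 'Phi_((lab i).1) \is a GRing.unit.
  by rewrite (monicP (Cyclotomic_monic _)) unitr1.
have /(congr1 pZtoC) := Pdiv.IdomainUnit.divp_eq lc ('X ^+ j).
rewrite rmorphD rmorphM /= map_polyXn -/r => /(congr1 (fun q => q.[lroot (lab i)])).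
by rewrite hornerD hornerM (rootP (root_lroot i)) mulr0 add0r hornerXn => <-.
Qed.

(** Multiplication by [block_newton] turns powers into values of Newton polynomials. Above the
    diagonal these are taken at one of their own roots and vanish; on the diagonal they are products
    of differences with the earlier roots of the block. *)
Lemma det_block_vdm : \det block_vdm = \prod_(d <- divisors n) vdm_prod (rts d).
Proof.
have size_newton d k : (k < totient d)%N -> size (newton d k) = k.+1.
  move=> kd; rewrite size_prod_XsubC size_takel // size_rootsC_Cyclotomic.
  exact: ltnW.
have DE : block_vdm *m block_newton = \matrix_(i, j)
    if (lab i).1 == (lab j).1 then (newton (lab j).1 (lab j).2).[lroot (lab i)]
    else 0.
  apply/matrixP => i j; rewrite !mxE; case: eqP => [eq_ij | neq_ij]; last first.
    rewrite big1 // => l _; rewrite !mxE; case: eqP => [<-|]; last by rewrite mul0r.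
    by case: eqP => // _; rewrite mulr0.
  rewrite -horner_lroot; last by rewrite size_newton ?eq_ij ?lab_lt.
  rewrite -(sum_same_block i (fun k => lroot (lab i) ^+ k * (newton (lab j).1 (lab j).2)`_k)).
  apply: eq_bigr => l _; rewrite !mxE; case: eqP => [<-|]; last by rewrite mul0r.
  by rewrite eq_ij eqxx.
have detE : \det block_newton = 1.
  rewrite -det_tr det_trig.
    apply: big1 => i _; rewrite !mxE eqxx.
    have : lead_coef (newton (lab i).1 (lab i).2) = 1 by exact/monicP/monic_prod_XsubC.
    by rewrite lead_coefE size_newton ?lab_lt.
  apply/is_trig_mxP => i j ij; rewrite !mxE; case: eqP => // eq_ij.
  rewrite nth_default // size_newton ?lab_lt //.
  by apply: lab_ltn ij _.
have := congr1 determinant DE; rewrite det_mulmx detE mulr1 => ->.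
rewrite det_trig; last first.
  apply/is_trig_mxP => i j ij; rewrite !mxE; case: eqP => // eq_ij.
  apply/rootP; rewrite root_prod_XsubC /lroot eq_ij.
  have kj := lab_ltn ij eq_ij; rewrite -(nth_take 0 kj) mem_nth //.
  by rewrite size_takel // size_rootsC_Cyclotomic ltnW // lab_lt.
transitivity (\prod_(i < n) (newton (lab i).1 (lab i).2).[lroot (lab i)]).
  by apply: eq_bigr => i _; rewrite mxE eqxx.
rewrite (big_lab _ (fun a => (newton a.1 a.2).[lroot a])) /=.
apply: eq_bigr => d _; rewrite -vdm_prod_take size_rootsC_Cyclotomic.
apply: eq_bigr => k _; rewrite horner_prod.
by apply: eq_bigr => z _; rewrite hornerXsubC.
Qed.

Lemma det_A_mat :
  ((\det (A_mat n))%:~R : algC) =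
    \prod_(d1 <- divisors n) \prod_(d2 <- divisors n | (d1 < d2)%N)
      resC 'Phi_d2 'Phi_d1.
Proof.
(* The roots of each Phi_d are distinct, so the determinant of D can be cancelled. *)
have D0 : \det block_vdm != 0.
  rewrite det_block_vdm prodf_seq_neq0; apply/allP => d dn /=.
  have : uniq (rts d).
    apply: uniq_rootsC_Cyclotomic.
    by move: dn; rewrite -dvdn_divisors //; exact: dvdn_gt0.
  elim: (rts d) => /= [|x s IHs]; first by rewrite oner_eq0.
  case/andP=> xNs /IHs s0; rewrite mulf_neq0 // prodf_seq_neq0.
  by apply/allP => y ys /=; rewrite subr_eq0; apply: contraNneq xNs => <-.
apply: (mulfI D0); rewrite -(det_map_mx (intmul 1)) -det_mulmx mul_block_vdm_A_mat det_tr.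
(* In label order the points are the concatenated root lists, so [vdm_prod_flatten] splits off
   exactly the determinant of D. *)
have rtE : map lroot (row_labels n) = flatten (map (fun d => rts d) (divisors n)).
  rewrite /row_labels map_flatten -map_comp; congr flatten; apply: eq_map => d /=.
  rewrite -map_comp /= -size_rootsC_Cyclotomic; exact: mkseq_nth.
have size_rt : size (map lroot (row_labels n)) = n by rewrite size_map size_row_labels.
have -> : \row_(i < n) lroot (lab i) = \row_(i < n) (map lroot (row_labels n))`_i.
  by apply/rowP => i; rewrite !mxE (nth_map (0%N, 0%N)) // size_row_labels.
by rewrite det_Vandermonde_seq // rtE vdm_prod_flatten ?sorted_divisors_ltn // det_block_vdm.
Qed.

End BlockMatrix.

Theorem theoremA2 (n : nat) (hn : (0 < n)%N) :
  ((\det (A_mat n))%:~R : algC) =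
    \prod_(d1 <- divisors n) \prod_(d2 <- divisors n | (d1 < d2)%N)
      resC 'Phi_d2 'Phi_d1
  /\
  \prod_(d1 <- divisors n) \prod_(d2 <- divisors n | (d1 < d2)%N)
      resC 'Phi_d2 'Phi_d1 =
    (-1) ^+ n.-1 *
    \prod_(p <- primes n)
      (p%:R : algC) ^+ ((n - n %/ p ^ logn p n) %/ (p - 1))%N.
Proof.
by split; [exact: det_A_mat | rewrite resC_prodE // nresC_prodE].
Qed.
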